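(* (Contraction isomorphism) For every coherence space $A$ there is a canonical linear isomorphism between $\mathrm{flag}\,A$ and $(\mathrm{flag}\,A)\triangleleft(\mathrm{flag}\,A)$.
   Context: A coherence space $A$ is a set $|A|$ (its web, possibly infinite, whose elements are called tokens) endowed with a reflexive and symmetric binary relation on $|A|$, called coherence and written $\alpha\sim\alpha'\,[A]$. Strict coherence $\alpha\frown\alpha'\,[A]$ means $\alpha\sim\alpha'\,[A]$ and $\alpha\neq\alpha'$. A clique of $A$ is a set of pairwise coherent tokens. Linear morphisms from $A$ to $B$ are maps $F$ from cliques of $A$ to cliques of $B$ that are monotone for inclusion, commute with unions of families of pairwise compatible cliques (two cliques being compatible when their union is a clique), and satisfy $F(x\cap x')=F(x)\cap F(x')$ whenever $x\cup x'$ is a clique. They compose as maps. A linear isomorphism is an invertible linear morphism whose inverse is linear. The connective ''before'': $A\triangleleft B$ is the coherence space with web $|A|\times|B|$, in which $(\alpha,\beta)\sim(\alpha',\beta')\,[A\triangleleft B]$ iff $\alpha\frown\alpha'\,[A]$ or ($\alpha=\alpha'$ and $\beta\sim\beta'\,[B]$). Let $2^{\omega}$ be the set of infinite words on $\{0,1\}$, with the product topology (Cantor space) and the lexicographic total order: $w_1<w_2$ iff there are a finite word $m$ and infinite words $w_1',w_2'$ with $w_1=m0w_1'$ and $w_2=m1w_2'$. For a coherence space $A$, the coherence space $\mathrm{flag}\,A$ is defined as follows. Its web is the set of continuous functions from $2^\omega$ to $|A|$, where $|A|$ has the discrete topology. Two functions $f,g$ in this web are strictly coherent, $f\frown g\,[\mathrm{flag}\,A]$,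 iff there exists $w\in 2^\omega$ such that $f(w)\frown g(w)\,[A]$ and $f(w')=g(w')$ for all $w'<w$. *)

(* Defs.v *)
From HB Require Import structures.
From mathcomp Require Import all_boot all_classical topology cantor.

Set Implicit Arguments.
Unset Strict Implicit.
Unset Printing Implicit Defensive.

Local Open Scope classical_set_scope.

Record cohSpace := CohSpace {
  web :> Type;
  coh : web -> web -> Prop;
  coh_refl : forall a, coh a a;
  coh_sym : forall a b, coh a b -> coh b a }.

Definition scoh (A : cohSpace) (a b : A) : Prop := coh a b /\ a <> b.

Definition is_clique (A : cohSpace) (x : set A) : Prop :=
  forall a b, x a -> x b -> coh a b.

Record clique (A : cohSpace) := Clique {
  tokens :> set A;
  cliqueP : is_clique tokens }.

Lemma clique_eq (A : cohSpace) (x y : clique A) :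
  tokens x = tokens y -> x = y.
Proof.
by case: x y => [x px] [y py] /= exy; subst y; rewrite (Prop_irrelevance px py).
Qed.

Definition compatible (A : cohSpace) (x y : clique A) : Prop :=
  is_clique (x `|` y).

Lemma is_clique_cap (A : cohSpace) (x y : clique A) : is_clique (x `&` y).
Proof. by move=> a b [xa _] [xb _]; exact: (cliqueP xa xb). Qed.

Definition clique_cap (A : cohSpace) (x y : clique A) : clique A :=
  Clique (@is_clique_cap A x y).

Definition pairwise_compatible (A : cohSpace) (X : set (clique A)) : Prop :=
  forall x y, X x -> X y -> compatible x y.

Lemma is_clique_bigcup (A : cohSpace) (X : set (clique A)) :
  pairwise_compatible X -> is_clique (\bigcup_(x in X) (x : set A)).
Proof.
by move=> cX a b [x Xx xa] [y Xy yb]; apply: (cX x y Xx Xy); [left|right].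
Qed.

Definition clique_bigcup (A : cohSpace) (X : set (clique A))
    (cX : pairwise_compatible X) : clique A :=
  Clique (is_clique_bigcup cX).

(* Unions range over arbitrary families, including the empty one, so that a
   linear map sends the empty clique to the empty clique. *)
Record is_linear (A B : cohSpace) (F : clique A -> clique B) : Prop := {
  linear_mono : forall x y : clique A, x `<=` y -> F x `<=` F y;
  linear_bigcup : forall (X : set (clique A)) (cX : pairwise_compatible X),
    F (clique_bigcup cX) = \bigcup_(x in X) (F x : set B) :> set B;
  linear_cap : forall x y : clique A, compatible x y ->
    F (clique_cap x y) = F x `&` F y :> set B }.

Record lin (A B : cohSpace) := Lin {
  lin_fun :> clique A -> clique B;
  lin_is_linear : is_linear lin_fun }.

Definition is_linear_iso (A B : cohSpace) (F : lin A B) : Prop :=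
  exists G : lin B A, cancel F G /\ cancel G F.

Section Before.
Variables A B : cohSpace.

Definition before_coh (p q : A * B) : Prop :=
  scoh p.1 q.1 \/ (p.1 = q.1 /\ coh p.2 q.2).

Lemma before_coh_refl p : before_coh p p.
Proof. by right; split => //; exact: coh_refl. Qed.

Lemma before_coh_sym p q : before_coh p q -> before_coh q p.
Proof.
move=> [[c n]|[e c]]; [left|right]; split; try exact: coh_sym.
- by move=> e; exact: n.
- by [].
Qed.

Definition before : cohSpace := CohSpace before_coh_refl before_coh_sym.

End Before.

Notation "A ◁ B" := (before A B) (at level 40, left associativity).

(* A word is a function from nat to bool, the letters 0 and 1 being [false] and
   [true]; [cantor_space] carries the product topology. *)

Definition consw (b : bool) (w : cantor_space) : cantor_space :=
  fun n => if n is k.+1 then w k else b.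

Definition catw (m : seq bool) (w : cantor_space) : cantor_space :=
  foldr consw w m.

Definition lexlt (w1 w2 : cantor_space) : Prop :=
  exists (m : seq bool) (w1' w2' : cantor_space),
    w1 = catw m (consw false w1') /\ w2 = catw m (consw true w2').

Lemma consw_continuous (b : bool) : continuous (consw b).
Proof.
move=> w; apply/cvg_sup => i; move: w.
apply/(@continuousP _ (initial_topology (@^~ i))) => _ [V oV <-].
case: i => [|n].
- have [Vb|nVb] := pselect (V b).
  + rewrite [X in open X](_ : _ = setT); first exact: openT.
    by apply/seteqP; split.
  + rewrite [X in open X](_ : _ = set0); first exact: open0.
    by apply/seteqP; split.
- rewrite [X in open X](_ : _ = proj n @^-1` V) //.
  by apply: open_comp => // + _; exact: proj_continuous.
Qed.

HB.instance Definition _ (b : bool) :=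
  @isContinuous.Build cantor_space cantor_space (consw b) (@consw_continuous b).

(* [{classic A}] is the type A with the choice structure that topological spaces
   require, and [discrete_topology] gives it the discrete topology. *)
Definition flag_web (A : cohSpace) : Type :=
  continuousType cantor_space (discrete_topology {classic A}).

Section Flag.
Variable A : cohSpace.

Definition flag_at (f : flag_web A) (w : cantor_space) : A := f w.

Definition flag_scoh (f g : flag_web A) : Prop :=
  exists w : cantor_space, scoh (flag_at f w) (flag_at g w) /\
    forall w', lexlt w' w -> flag_at f w' = flag_at g w'.

Definition flag_coh (f g : flag_web A) : Prop := f = g \/ flag_scoh f g.

Lemma flag_coh_refl f : flag_coh f f.
Proof. by left. Qed.

Lemma flag_coh_sym f g : flag_coh f g -> flag_coh g f.
Proof.
move=> [->|[w [[c n] e]]]; [by left|right; exists w; split].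
- by split; [exact: coh_sym | move=> e'; exact: n].
- by move=> w' lw; rewrite e.
Qed.

Definition flag : cohSpace := CohSpace flag_coh_refl flag_coh_sym.

Lemma scoh_flagE (f g : flag) : scoh f g <-> flag_scoh f g.
Proof.
split=> [[[->//|//]]|fg]; split; first by right.
by case: fg => w [[_ n] _] e; apply: n; rewrite e.
Qed.

(* [flag_half b f] is the function [w |-> f (b w)]: the restriction of f to one
   of the two halves of the Cantor space, each a copy of the whole space. *)
Definition flag_half (b : bool) (f : flag) : flag :=
  ((f : flag_web A) \o consw b : continuousType _ _).

Definition flag_split (f : flag) : flag ◁ flag :=
  (flag_half false f, flag_half true f).

End Flag.

(* Main.v *)
(* A web bijection that preserves and reflects coherence acts on cliques by
   direct image as a linear isomorphism; here the bijection cuts a continuous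
   function on the Cantor space into its restrictions to the words beginning
   with 0 and with 1. If the first difference between f and g is witnessed at
   0v, the left halves are strictly coherent at v; if it is at 1v, the left
   halves coincide, every word 0u being smaller than 1v, and the right halves
   are strictly coherent at v. *)

Require Import Defs.
From mathcomp Require Import all_boot all_classical topology cantor.
Local Open Scope classical_set_scope.

Section ImageIso.
Variables (A B : cohSpace) (phi : A -> B).
Hypothesis phi_coh : forall a b, coh a b <-> coh (phi a) (phi b).
Hypothesis phi_inj : injective phi.

Lemma is_clique_image (x : clique A) : is_clique (phi @` x).
Proof.
by move=> _ _ [a xa <-] [b xb <-]; apply/phi_coh; exact: (cliqueP xa xb).
Qed.

Definition clique_image (x : clique A) : clique B :=
  Clique (@is_clique_image x).

Lemma is_linear_clique_image : is_linear clique_image.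
Proof.
split=> [x y xy|X cX|x y cxy] /=.
- exact: image_subset.
- by rewrite image_bigcup.
- apply/seteqP; split=> [_ [a [xa ya] <-]|_ [[a xa <-] [b yb e]]].
    by split; exists a.
  (* A token of both images has a preimage in [x] and one in [y]; injectivity identifies them. *)
  by exists a => //; split => //; rewrite -(phi_inj _ _ e).
Qed.

End ImageIso.

Lemma is_linear_iso_image (A B : cohSpace) (phi : A -> B)
    (phi_coh : forall a b, coh a b <-> coh (phi a) (phi b))
    (phi_bij : bijective phi) :
  is_linear_iso (Lin (is_linear_clique_image _ _ _ phi_coh (bij_inj phi_bij))).
Proof.
case: (phi_bij) => psi phiK psiK.
have psi_coh a b : coh a b <-> coh (psi a) (psi b) by rewrite phi_coh !psiK.
exists (Lin (is_linear_clique_image _ _ _ psi_coh (can_inj psiK))).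
by split=> x; apply: clique_eq; rewrite /= image_comp;
  apply: eq_image_id => a _ /=.
Qed.

Definition tailw (w : cantor_space) : cantor_space := fun n => w n.+1.

Lemma consw_tailw w : consw (w 0) (tailw w) = w.
Proof. by apply/funext => -[]. Qed.

Lemma tailw_continuous : continuous tailw.
Proof.
move=> w; apply/cvg_sup => i; move: w.
apply/(@continuousP _ (initial_topology (@^~ i))) => _ [V oV <-].
rewrite [X in open X](_ : _ = proj i.+1 @^-1` V) //.
by apply: open_comp => // + _; exact: proj_continuous.
Qed.

Lemma lexlt_consw b v w : lexlt (consw b v) (consw b w) <-> lexlt v w.
Proof.
split=> -[m [v' [w' [ev ew]]]]; last first.
  by exists (b :: m), v', w'; rewrite ev ew.
case: m ev ew => [|c m] /= ev ew.
  (* An empty common prefix would force [b] to be both 0 and 1. *)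
  by have := congr1 (@^~ 0) ev; have := congr1 (@^~ 0) ew => /= ->.
exists m, v', w'; split; apply/funext => n.
  exact: (congr1 (@^~ n.+1) ev).
exact: (congr1 (@^~ n.+1) ew).
Qed.

Lemma lexlt_consw_false_true v w : lexlt (consw false v) (consw true w).
Proof. by exists [::], v, w. Qed.

Lemma not_lexlt_consw_true_false v w : ~ lexlt (consw true v) (consw false w).
Proof.
move=> -[[|c m] [v' [w' [ev ew]]]].
  by have := congr1 (@^~ 0) ev.
have := congr1 (@^~ 0) ev; have := congr1 (@^~ 0) ew => /= <-.
by [].
Qed.

Section FlagSplit.
Variable A : cohSpace.
Implicit Types f g : flag A.

Lemma flag_at_half b f w : flag_at (flag_half b f) w = flag_at f (consw b w).
Proof. by []. Qed.

Lemma flag_atP f g : (forall w, flag_at f w = flag_at g w) -> f = g.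
Proof. by move=> fg; exact/continuousEP. Qed.

Definition glue_fun f g (w : cantor_space) : discrete_topology {classic A} :=
  if w 0 then flag_at g (tailw w) else flag_at f (tailw w).

(** The first letter is locally constant, so near any word the glued function coincides with [f] or
    [g] composed with [tailw]. *)
Lemma glue_fun_continuous f g : continuous (glue_fun f g).
Proof.
have tail_cts h : continuous ((h : flag_web A) \o tailw).
  move=> w; apply: continuous_comp; first exact: tailw_continuous.
  exact: (@cts_fun _ _ (h : flag_web A)).
move=> w; have w0 : \forall v \near w, v 0 = w 0.
  have /(_ _ (discrete_set1 _)) := @proj_continuous nat (fun=> bool) 0 w.
  exact.
rewrite /continuous_at {2}/glue_fun; case: (w 0) w0 => w0.
  apply: cvg_trans (tail_cts g w); apply: near_eq_cvg.
  by apply: filterS w0 => v; rewrite /glue_fun => ->.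
apply: cvg_trans (tail_cts f w); apply: near_eq_cvg.
by apply: filterS w0 => v; rewrite /glue_fun => ->.
Qed.

Definition flag_glue (p : flag A ◁ flag A) : flag A :=
  mkcts (glue_fun_continuous p.1 p.2) : continuousType _ _.

Lemma flag_splitK : cancel (@flag_split A) flag_glue.
Proof.
move=> f; apply: flag_atP => w; rewrite -[in RHS](consw_tailw w).
by rewrite /flag_at /= /mkcts /glue_fun /=; case: (w 0).
Qed.

(** [tailw (consw b w)] computes to [w], so each half is recovered by conversion. *)
Lemma flag_glueK : cancel flag_glue (@flag_split A).
Proof. by case=> f g; congr pair; exact: flag_atP. Qed.

Lemma flag_split_coh f g : coh f g <-> coh (flag_split f) (flag_split g).
Proof.
split=> [[->|[w [fgw eqfg]]]|]; first exact: coh_refl.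
- case: (w 0) (consw_tailw w) => ew; rewrite -ew in fgw eqfg.
    right; split.
      apply: flag_atP => v; apply: eqfg; exact: lexlt_consw_false_true.
    right; exists (tailw w); split=> // v vw; apply: eqfg.
    by apply/lexlt_consw.
  left; apply/scoh_flagE; exists (tailw w); split=> // v vw; apply: eqfg.
  by apply/lexlt_consw.
(* Conversely, a witness [w] for the left halves gives 0[w], below which every word begins with 0.
   If the left halves coincide, either the right ones do too and [f = g], or a witness [w] for them
   gives 1[w]; [e0] then covers the smaller words that begin with 0. *)
- case=> [/scoh_flagE[w [fgw eqfg]]|[/= e0 [e1|[w [fgw eqfg]]]]].
  + right; exists (consw false w); split=> // v; rewrite -(consw_tailw v).
    case: (v 0) => [/not_lexlt_consw_true_false //|/lexlt_consw]; exact: eqfg.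
  + left; apply: flag_atP => v; rewrite -(consw_tailw v) -!flag_at_half.
    by case: (v 0); rewrite ?e0 ?e1.
  + right; exists (consw true w); split=> // v; rewrite -(consw_tailw v).
    case: (v 0) => [/lexlt_consw|_]; first exact: eqfg.
    by rewrite -!flag_at_half e0.
Qed.

End FlagSplit.

Theorem proposition17 (A : cohSpace) :
  exists F : lin (flag A) (flag A ◁ flag A),
    is_linear_iso F /\
    forall x : clique (flag A),
      F x = [set flag_split f | f in x] :> set (flag A ◁ flag A).
Proof.
have split_bij : bijective (@flag_split A).
  by exists (flag_glue A); [exact: flag_splitK | exact: flag_glueK].
pose iso := is_linear_iso_image _ _ _ (flag_split_coh A) split_bij.
(* The action on cliques is the direct image by construction. *)
by eexists; split; first exact: iso.
Qed.
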